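(* Let $\mathcal A$ be a prohomological category and $U\colon\mathcal A\to\mathcal X$ a regular conservative functor with $\mathcal X$ homological. Then, for any object $A\in\mathcal A$, the poset of normal spans on $A$ is isomorphic to the poset of $U$-ideals of $A$ (with the usual order on subobjects of $U(A)$).
   Context: A finitely complete category is propointed if it admits an initial object $0$ and the unique morphism $0\to1$ is a universal extremal epimorphism (an extremal epimorphism all of whose pullbacks are extremal epimorphisms). A prohomological category is a propointed regular category that is protomodular in the sense of Bourn (for every morphism $v\colon Y\to X$ the pullback functor from the category of split epimorphisms with chosen section over $X$ to that over $Y$ is conservative); a homological category is a pointed regular protomodular category. A regular functor between regular categories is one preserving finite limits and regular epimorphisms; conservative means isomorphism-reflecting. In a category with an initial object $0$, the kernel of a morphism $f\colon A\to B$ is a span $(H,e\colon H\to0,h\colon H\to A)$ such that $f\circ h=!_B\circ e$, with $!_B\colon0\to B$ the unique morphism, and this square is a pullback. A normal span over (or on) $A$ is a span $(H,e\colon H\to 0,h\colon H\to A)$ that is the kernel of some morphism $f\colon A\to B$. For normal spans over $A$, write $(H,e,h)\le(H',e',h')$ if there is a (necessarily unique) morphism $\eta\colon H\to H'$ with $e'\circ\eta=e$ and $h'\circ\eta=h$. This is a preorder; identifying $H$ and $H'$ whenever $H\le H'$ and $H'\le H$ gives the (possibly large) poset of normal spans on $A$. A $U$-ideal of $A\in\mathcal A$ is a morphism $i\colon I\to U(A)$ in $\mathcal X$ for which there exists a morphism $f\colon A\to B$ in $\mathcal A$ such that $i$ is a kernel of $U(f)$ (in the usual sense in the pointed category $\mathcal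 X$). Each $U$-ideal is identified with the subobject of $U(A)$ it represents. *)

(* Defs.v *)
From Stdlib Require Import List FinFun RelationClasses.
From Stdlib Require Import ClassicalEpsilon FunctionalExtensionality.
From Stdlib Require Import PropExtensionality ProofIrrelevance.

Set Implicit Arguments.
Unset Strict Implicit.
Unset Printing Implicit Defensive.

(** * Categories and functors *)

Declare Scope cat_scope.
Local Open Scope cat_scope.

Record Category : Type := {
  Ob :> Type;
  Hom : Ob -> Ob -> Type;
  idm : forall x : Ob, Hom x x;
  comp : forall x y z : Ob, Hom y z -> Hom x y -> Hom x z;
  comp_idl : forall (x y : Ob) (f : Hom x y), comp (idm y) f = f;
  comp_idr : forall (x y : Ob) (f : Hom x y), comp f (idm x) = f;
  comp_assoc : forall (w x y z : Ob) (h : Hom y z) (g : Hom x y) (f : Hom w x),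
    comp h (comp g f) = comp (comp h g) f
}.

Arguments Hom {c} x y.
Arguments idm {c} x.
Arguments comp {c x y z} g f.
Notation "g ∘ f" := (comp g f) (at level 40, left associativity) : cat_scope.

Record Functor (C D : Category) : Type := {
  fob :> C -> D;
  fmap : forall x y : C, Hom x y -> Hom (fob x) (fob y);
  fmap_id : forall x : C, fmap (idm x) = idm (fob x);
  fmap_comp : forall (x y z : C) (g : Hom y z) (f : Hom x y),
    fmap (g ∘ f) = fmap g ∘ fmap f
}.

Arguments fmap {C D} F {x y} f : rename.

Definition functor_comp (C D E : Category) (G : Functor D E) (F : Functor C D) :
  Functor C E.
Proof.
  refine {| fob := fun x => G (F x); fmap := fun x y f => fmap G (fmap F f) |}.
  - intros x. now rewrite !fmap_id.
  - intros x y z g f. now rewrite !fmap_comp.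
Defined.

Definition IsIso (C : Category) (x y : C) (f : Hom x y) : Prop :=
  exists g : Hom y x, g ∘ f = idm x /\ f ∘ g = idm y.

Definition IsMono (C : Category) (x y : C) (m : Hom x y) : Prop :=
  forall (w : C) (a b : Hom w x), m ∘ a = m ∘ b -> a = b.

Definition IsEpi (C : Category) (x y : C) (e : Hom x y) : Prop :=
  forall (z : C) (a b : Hom y z), a ∘ e = b ∘ e -> a = b.

Definition Conservative (C D : Category) (F : Functor C D) : Prop :=
  forall (x y : C) (f : Hom x y), IsIso (fmap F f) -> IsIso f.

(** * Limits and colimits *)

Record Cone (J C : Category) (D : Functor J C) : Type := {
  vertex : C;
  leg : forall j : J, Hom vertex (D j);
  leg_natural : forall (i j : J) (u : Hom i j), fmap D u ∘ leg i = leg j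
}.

Arguments vertex {J C D} c.
Arguments leg {J C D} c j.

Definition IsLimit (J C : Category) (D : Functor J C) (c : Cone D) : Prop :=
  forall d : Cone D,
    exists! u : Hom (vertex d) (vertex c), forall j : J, leg c j ∘ u = leg d j.

Definition map_cone (J C E : Category) (D : Functor J C) (F : Functor C E)
  (c : Cone D) : Cone (functor_comp F D).
Proof.
  refine {| vertex := F (vertex c);
            leg := fun j => fmap F (leg c j) : Hom _ (functor_comp F D j) |}.
  intros i j u. cbn. now rewrite <- fmap_comp, leg_natural.
Defined.

Definition FiniteCategory (J : Category) : Prop :=
  Finite J /\ forall i j : J, Finite (Hom i j).

Definition FinitelyComplete (C : Category) : Prop :=
  forall J : Category, FiniteCategory J ->
  forall D : Functor J C, exists c : Cone D, IsLimit c.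

Definition PreservesFiniteLimits (C E : Category) (F : Functor C E) : Prop :=
  forall J : Category, FiniteCategory J ->
  forall (D : Functor J C) (c : Cone D), IsLimit c -> IsLimit (map_cone F c).

Definition IsTerminal (C : Category) (t : C) : Prop :=
  forall x : C, exists! f : Hom x t, True.

Definition IsInitial (C : Category) (i : C) : Prop :=
  forall x : C, exists! f : Hom i x, True.

Definition IsZeroObject (C : Category) (z : C) : Prop :=
  IsInitial z /\ IsTerminal z.

Definition IsPullback (C : Category) (x y z p : C) (f : Hom x z) (g : Hom y z)
  (p1 : Hom p x) (p2 : Hom p y) : Prop :=
  f ∘ p1 = g ∘ p2 /\
  forall (w : C) (a : Hom w x) (b : Hom w y), f ∘ a = g ∘ b ->
    exists! u : Hom w p, p1 ∘ u = a /\ p2 ∘ u = b.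

Definition IsCoequalizer (C : Category) (x y q : C) (f g : Hom x y)
  (e : Hom y q) : Prop :=
  e ∘ f = e ∘ g /\
  forall (w : C) (a : Hom y w), a ∘ f = a ∘ g -> exists! u : Hom q w, u ∘ e = a.

(** * Regular categories and regular functors *)

Definition IsRegularEpi (C : Category) (y q : C) (e : Hom y q) : Prop :=
  exists (x : C) (f g : Hom x y), IsCoequalizer f g e.

Definition IsExtremalEpi (C : Category) (x y : C) (e : Hom x y) : Prop :=
  IsEpi e /\
  forall (z : C) (m : Hom z y) (g : Hom x z), IsMono m -> m ∘ g = e -> IsIso m.

Definition IsUniversalExtremalEpi (C : Category) (x y : C) (e : Hom x y) : Prop :=
  IsExtremalEpi e /\
  forall (w p : C) (g : Hom w y) (p1 : Hom p x) (p2 : Hom p w),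
    IsPullback e g p1 p2 -> IsExtremalEpi p2.

Definition RegularCategory (C : Category) : Prop :=
  FinitelyComplete C /\
  (forall (x y k : C) (f : Hom x y) (k1 k2 : Hom k x), IsPullback f f k1 k2 ->
     exists (q : C) (e : Hom x q), IsCoequalizer k1 k2 e) /\
  (forall (x y w p : C) (e : Hom x y) (g : Hom w y) (p1 : Hom p x) (p2 : Hom p w),
     IsPullback e g p1 p2 -> IsRegularEpi e -> IsRegularEpi p2).

Definition RegularFunctor (C D : Category) (F : Functor C D) : Prop :=
  PreservesFiniteLimits F /\
  forall (x y : C) (e : Hom x y), IsRegularEpi e -> IsRegularEpi (fmap F e).

(** * Protomodularity *)

Record Point (C : Category) (x : C) : Type := {
  pt_ob : C;
  pt_epi : Hom pt_ob x;
  pt_sec : Hom x pt_ob;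
  pt_split : pt_epi ∘ pt_sec = idm x
}.

Record PointHom (C : Category) (x : C) (a b : Point x) : Type := {
  pth_mor : Hom (pt_ob a) (pt_ob b);
  pth_epi : pt_epi b ∘ pth_mor = pt_epi a;
  pth_sec : pth_mor ∘ pt_sec a = pt_sec b
}.

Lemma PointHom_eq (C : Category) (x : C) (a b : Point x) (f g : PointHom a b) :
  pth_mor f = pth_mor g -> f = g.
Proof.
  destruct f as [f fe fs], g as [g ge gs]; cbn; intros <-.
  f_equal; apply proof_irrelevance.
Qed.

Definition point_id (C : Category) (x : C) (a : Point x) : PointHom a a :=
  {| pth_mor := idm (pt_ob a);
     pth_epi := comp_idr (pt_epi a);
     pth_sec := comp_idl (pt_sec a) |}.

Definition point_comp (C : Category) (x : C) (a b c : Point x)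
  (g : PointHom b c) (f : PointHom a b) : PointHom a c.
Proof.
  refine {| pth_mor := pth_mor g ∘ pth_mor f |}.
  - now rewrite comp_assoc, !pth_epi.
  - now rewrite <- comp_assoc, !pth_sec.
Defined.

Definition Points (C : Category) (x : C) : Category.
Proof.
  refine {| Ob := Point x; Hom := @PointHom C x; idm := @point_id C x;
            comp := @point_comp C x |}.
  - intros a b f. apply PointHom_eq. apply comp_idl.
  - intros a b f. apply PointHom_eq. apply comp_idr.
  - intros a b c d h g f. apply PointHom_eq. apply comp_assoc.
Defined.

Record Pullback (C : Category) (x y z : C) (f : Hom x z) (g : Hom y z) : Type := {
  pb_ob : C;
  pb_fst : Hom pb_ob x;
  pb_snd : Hom pb_ob y;
  pb_spec : IsPullback f g pb_fst pb_snd
}.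

Definition PullbackChoice (C : Category) : Type :=
  forall (x y z : C) (f : Hom x z) (g : Hom y z), Pullback f g.

Definition pb_lift_sig (C : Category) (x y z : C) (f : Hom x z) (g : Hom y z)
  (P : Pullback f g) (w : C) (a : Hom w x) (b : Hom w y) (H : f ∘ a = g ∘ b) :
  {u : Hom w (pb_ob P) | pb_fst P ∘ u = a /\ pb_snd P ∘ u = b}.
Proof.
  apply constructive_indefinite_description.
  destruct (proj2 (pb_spec P) w a b H) as [u [Hu _]]. now exists u.
Qed.

Definition pb_lift (C : Category) (x y z : C) (f : Hom x z) (g : Hom y z)
  (P : Pullback f g) (w : C) (a : Hom w x) (b : Hom w y) (H : f ∘ a = g ∘ b) :
  Hom w (pb_ob P) :=
  proj1_sig (pb_lift_sig P H).

Lemma pb_lift_fst (C : Category) (x y z : C) (f : Hom x z) (g : Hom y z)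
  (P : Pullback f g) (w : C) (a : Hom w x) (b : Hom w y) (H : f ∘ a = g ∘ b) :
  pb_fst P ∘ pb_lift P H = a.
Proof. exact (proj1 (proj2_sig (pb_lift_sig P H))). Qed.

Lemma pb_lift_snd (C : Category) (x y z : C) (f : Hom x z) (g : Hom y z)
  (P : Pullback f g) (w : C) (a : Hom w x) (b : Hom w y) (H : f ∘ a = g ∘ b) :
  pb_snd P ∘ pb_lift P H = b.
Proof. exact (proj2 (proj2_sig (pb_lift_sig P H))). Qed.

Lemma pb_jointly_monic (C : Category) (x y z : C) (f : Hom x z) (g : Hom y z)
  (P : Pullback f g) (w : C) (u v : Hom w (pb_ob P)) :
  pb_fst P ∘ u = pb_fst P ∘ v -> pb_snd P ∘ u = pb_snd P ∘ v -> u = v.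
Proof.
  intros H1 H2. destruct (pb_spec P) as [Hc Hu].
  destruct (Hu w (pb_fst P ∘ v) (pb_snd P ∘ v)) as [t [_ Ht]].
  - now rewrite !comp_assoc, Hc.
  - transitivity t; [symmetry|]; apply Ht; auto.
Qed.

Lemma pull_point_compat (C : Category) (x y : C) (v : Hom y x) (a : Point x) :
  pt_epi a ∘ (pt_sec a ∘ v) = v ∘ idm y.
Proof. now rewrite comp_assoc, pt_split, comp_idl, comp_idr. Qed.

Definition pull_point (C : Category) (pb : PullbackChoice C) (x y : C)
  (v : Hom y x) (a : Point x) : Point y :=
  {| pt_ob := pb_ob (pb _ _ _ (pt_epi a) v);
     pt_epi := pb_snd (pb _ _ _ (pt_epi a) v);
     pt_sec := pb_lift (pb _ _ _ (pt_epi a) v) (pull_point_compat v a);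
     pt_split := pb_lift_snd (pb _ _ _ (pt_epi a) v) (pull_point_compat v a) |}.

Lemma pull_hom_compat (C : Category) (pb : PullbackChoice C) (x y : C)
  (v : Hom y x) (a b : Point x) (f : PointHom a b) :
  pt_epi b ∘ (pth_mor f ∘ pb_fst (pb _ _ _ (pt_epi a) v))
  = v ∘ pb_snd (pb _ _ _ (pt_epi a) v).
Proof.
  rewrite comp_assoc, pth_epi. exact (proj1 (pb_spec (pb _ _ _ (pt_epi a) v))).
Qed.

Definition pull_hom (C : Category) (pb : PullbackChoice C) (x y : C)
  (v : Hom y x) (a b : Point x) (f : PointHom a b) :
  PointHom (pull_point pb v a) (pull_point pb v b).
Proof.
  refine {| pth_mor := pb_lift (pb _ _ _ (pt_epi b) v) (pull_hom_compat pb v f)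
              : Hom (pt_ob (pull_point pb v a)) (pt_ob (pull_point pb v b)) |}.
  - apply pb_lift_snd.
  - cbn. apply pb_jointly_monic.
    + now rewrite comp_assoc, !pb_lift_fst, <- comp_assoc, pb_lift_fst,
        comp_assoc, pth_sec.
    + now rewrite comp_assoc, !pb_lift_snd.
Defined.

Definition pullback_functor (C : Category) (pb : PullbackChoice C) (x y : C)
  (v : Hom y x) : Functor (Points x) (Points y).
Proof.
  refine {| fob := pull_point pb v : Points x -> Points y;
            fmap := @pull_hom C pb x y v |}.
  - intros a. apply PointHom_eq. cbn. apply pb_jointly_monic.
    + now rewrite pb_lift_fst, comp_idl, comp_idr.
    + now rewrite pb_lift_snd, comp_idr.
  - intros a b c g f. apply PointHom_eq. cbn. apply pb_jointly_monic.
    + now rewrite comp_assoc, !pb_lift_fst, <- !comp_assoc, pb_lift_fst.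
    + now rewrite comp_assoc, !pb_lift_snd.
Defined.

(* Different choices of pullbacks yield isomorphic functors, so quantifying over
   all choices is immaterial; a choice exists in any finitely complete category. *)
Definition Protomodular (C : Category) : Prop :=
  forall (pb : PullbackChoice C) (x y : C) (v : Hom y x),
    Conservative (pullback_functor pb v).

(** * Homological and prohomological categories *)

Definition Pointed (C : Category) : Prop := exists z : C, IsZeroObject z.

Definition Propointed (C : Category) (zero : C) : Prop :=
  FinitelyComplete C /\ IsInitial zero /\
  forall (one : C) (u : Hom zero one), IsTerminal one -> IsUniversalExtremalEpi u.

Definition Homological (C : Category) : Prop :=
  Pointed C /\ RegularCategory C /\ Protomodular C.

Definition Prohomological (C : Category) (zero : C) : Prop :=
  Propointed zero /\ RegularCategory C /\ Protomodular C.

(** * Posets *)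

Record Preorder : Type := {
  pre_car :> Type;
  pre_le : pre_car -> pre_car -> Prop;
  pre_is_preorder : PreOrder pre_le
}.

Record Poset : Type := {
  po_car :> Type;
  po_le : po_car -> po_car -> Prop;
  po_is_preorder : PreOrder po_le;
  po_antisym : forall p q : po_car, po_le p q -> po_le q p -> p = q
}.

Arguments pre_le {p} _ _ : rename.
Arguments po_le {p} _ _ : rename.

Definition PosetIso (P Q : Poset) : Prop :=
  exists (f : P -> Q) (g : Q -> P),
    (forall p p' : P, po_le p p' -> po_le (f p) (f p')) /\
    (forall q q' : Q, po_le q q' -> po_le (g q) (g q')) /\
    (forall p : P, g (f p) = p) /\
    (forall q : Q, f (g q) = q).

Definition pre_equiv (P : Preorder) (p q : P) : Prop := pre_le p q /\ pre_le q p.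

Definition EquivClass (P : Preorder) : Type :=
  {S : P -> Prop | exists p : P, S = pre_equiv p}.

Definition class_le (P : Preorder) (S T : EquivClass P) : Prop :=
  exists p q : P, proj1_sig S p /\ proj1_sig T q /\ pre_le p q.

Lemma class_le_rep (P : Preorder) (S T : EquivClass P) (s t : P) :
  proj1_sig S = pre_equiv s -> proj1_sig T = pre_equiv t ->
  class_le S T <-> pre_le s t.
Proof.
  intros HS HT. unfold class_le. rewrite HS, HT. unfold pre_equiv.
  pose proof (pre_is_preorder P) as [Hrefl Htrans]. split.
  - intros (p & q & [Hsp _] & [_ Hqt] & Hpq).
    exact (Htrans _ _ _ Hsp (Htrans _ _ _ Hpq Hqt)).
  - intros H. exists s, t. auto.
Qed.

Definition poset_reflection (P : Preorder) : Poset.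
Proof.
  refine {| po_car := EquivClass P; po_le := @class_le P |}.
  - pose proof (pre_is_preorder P) as [Hrefl Htrans]. split.
    + intros S. destruct (proj2_sig S) as [s Hs].
      apply (class_le_rep Hs Hs). apply Hrefl.
    + intros S T V HST HTV.
      destruct (proj2_sig S) as [s Hs], (proj2_sig T) as [t Ht],
        (proj2_sig V) as [v Hv].
      apply (class_le_rep Hs Hv).
      apply (class_le_rep Hs Ht) in HST. apply (class_le_rep Ht Hv) in HTV.
      exact (Htrans _ _ _ HST HTV).
  - intros S T HST HTS.
    pose proof (pre_is_preorder P) as [_ Htrans].
    destruct S as [S [s Hs]], T as [T [t Ht]].
    pose proof (proj1 (@class_le_rep P (exist _ S _) (exist _ T _) s t Hs Ht) HST)
      as Hst.
    pose proof (proj1 (@class_le_rep P (exist _ T _) (exist _ S _) t s Ht Hs) HTS)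
      as Hts.
    assert (E : S = T).
    { rewrite Hs, Ht. apply functional_extensionality. intros p.
      apply propositional_extensionality. unfold pre_equiv.
      split; intros [H1 H2]; split; eauto. }
    destruct E. f_equal. apply proof_irrelevance.
Defined.

(** * Normal spans *)

(* When [zero] is initial, [u] is the unique morphism from [zero] to [b]. *)
Definition IsKernelSpan (C : Category) (zero a b : C) (f : Hom a b)
  (k : C) (e : Hom k zero) (h : Hom k a) : Prop :=
  exists u : Hom zero b, IsPullback f u h e.

Record NormalSpan (C : Category) (zero a : C) : Type := {
  ns_ob : C;
  ns_e : Hom ns_ob zero;
  ns_h : Hom ns_ob a;
  ns_normal : exists (b : C) (f : Hom a b), IsKernelSpan f ns_e ns_h
}.

Definition NormalSpan_le (C : Category) (zero a : C) (s t : NormalSpan zero a) :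
  Prop :=
  exists eta : Hom (ns_ob s) (ns_ob t),
    ns_e t ∘ eta = ns_e s /\ ns_h t ∘ eta = ns_h s.

Definition NormalSpan_preorder (C : Category) (zero a : C) : Preorder.
Proof.
  refine {| pre_car := NormalSpan zero a; pre_le := @NormalSpan_le C zero a |}.
  split.
  - intros s. exists (idm _). now rewrite !comp_idr.
  - intros r s t [u [Hu1 Hu2]] [v [Hv1 Hv2]]. exists (v ∘ u).
    now rewrite !comp_assoc, Hv1, Hv2.
Defined.

Definition NormalSpanPoset (C : Category) (zero a : C) : Poset :=
  poset_reflection (NormalSpan_preorder zero a).

(** * U-ideals *)

Definition IsZeroMorphism (C : Category) (x y : C) (f : Hom x y) : Prop :=
  exists (z : C) (u : Hom z y) (t : Hom x z), IsZeroObject z /\ f = u ∘ t.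

Definition IsKernel (C : Category) (k x y : C) (g : Hom x y) (i : Hom k x) : Prop :=
  IsZeroMorphism (g ∘ i) /\
  forall (w : C) (a : Hom w x), IsZeroMorphism (g ∘ a) ->
    exists! u : Hom w k, i ∘ u = a.

Record UIdeal (C D : Category) (U : Functor C D) (a : C) : Type := {
  ui_ob : D;
  ui_mor : Hom ui_ob (U a);
  ui_kernel : exists (b : C) (f : Hom a b), IsKernel (fmap U f) ui_mor
}.

Definition UIdeal_le (C D : Category) (U : Functor C D) (a : C)
  (s t : UIdeal U a) : Prop :=
  exists j : Hom (ui_ob s) (ui_ob t), ui_mor t ∘ j = ui_mor s.

Definition UIdeal_preorder (C D : Category) (U : Functor C D) (a : C) : Preorder.
Proof.
  refine {| pre_car := UIdeal U a; pre_le := @UIdeal_le C D U a |}.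
  split.
  - intros s. exists (idm _). apply comp_idr.
  - intros r s t [u Hu] [v Hv]. exists (v ∘ u).
    now rewrite comp_assoc, Hv.
Defined.

(* Kernels are monic, so the classes below are exactly the subobjects of [U a]
   represented by U-ideals, ordered as subobjects. *)
Definition UIdealPoset (C D : Category) (U : Functor C D) (a : C) : Poset :=
  poset_reflection (UIdeal_preorder U a).

(* Main.v *)
(** Normal spans on [a] and U-ideals of [a] are both indexed by the morphisms
    [f] out of [a], so it suffices to compare the two orders on those indices.
    In a protomodular category the kernel span of [f] is the pullback of the
    point (first projection, diagonal) of the kernel pair R[f] along [0 -> a].
    Conservativity of this pullback, applied to the inclusion of the
    intersection of R[f] and R[f'] into R[f], shows that Ker f <= Ker f' iff
    R[f] <= R[f'].  This holds both in A and in X, and the order on kernel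
    pairs is preserved and reflected by U, which preserves finite limits and
    is faithful. *)

Require Import Defs.
From Stdlib Require Import List FinFun.
From Stdlib Require Import ClassicalEpsilon FunctionalExtensionality.
From Stdlib Require Import ProofIrrelevance.

Set Implicit Arguments.
Unset Strict Implicit.
Unset Printing Implicit Defensive.

Local Open Scope cat_scope.

(** * Limits of star-shaped finite diagrams *)

Section Star.

(* The free category on a graph whose arrows all end at [None]: it yields both
   cospans ([S = bool], [T s = unit]) and parallel pairs ([S = unit],
   [T s = bool]). *)
Variables (S : Type) (T : S -> Type).

(** Arrows between outer objects are equality proofs, so only identities occur there and no
    decidable equality on [S] is needed to define them. *)
Definition star_hom (i j : option S) : Type :=
  match i, j with
  | Some s, Some s' => s = s'
  | Some s, None => T s
  | None, Some _ => Empty_set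
  | None, None => unit
  end.

Definition star_id (i : option S) : star_hom i i :=
  match i with Some s => eq_refl s | None => tt end.

Definition star_comp (i j k : option S) :
  star_hom j k -> star_hom i j -> star_hom i k.
Proof.
  destruct i as [s|], j as [s'|], k as [s''|]; cbn; intros g f;
    try destruct f; try destruct g; first [exact eq_refl | exact tt | assumption].
Defined.

Definition Star : Category.
Proof.
  refine {| Ob := option S; Hom := star_hom; idm := star_id; comp := star_comp |}.
  - intros [s|] [s'|] f; cbn in *; try destruct f; reflexivity.
  - intros [s|] [s'|] f; cbn in *; try destruct f; reflexivity.
  - intros [s|] [s'|] [s''|] [s'''|] h g f; cbn in *;
      try destruct f; try destruct g; try destruct h; reflexivity.
Defined.

Lemma Star_finite : Finite S -> (forall s, Finite (T s)) -> FiniteCategory Star.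
Proof.
  intros [l Hl] HT. split.
  - exists (None :: map Some l). intros [s|]; [right|now left].
    now apply in_map, Hl.
  - intros [s|] [s'|]; cbn.
    (* Classically [s = s'] is empty or inhabited, and proof irrelevance leaves at most one
       element. *)
    + destruct (excluded_middle_informative (s = s')) as [E|N].
      * exists (E :: nil). intros E'. left. apply proof_irrelevance.
      * exists nil. intros E'. now destruct N.
    + apply HT.
    + exists nil. intros [].
    + exists (tt :: nil). intros []. now left.
Qed.

Variables (C : Category) (o : S -> C) (b : C) (m : forall s, T s -> Hom (o s) b).

Definition star_ob (i : Star) : C :=
  match i with Some s => o s | None => b end.

Definition star_map (i j : Star) : Hom i j -> Hom (star_ob i) (star_ob j).
Proof.
  destruct i as [s|], j as [s'|]; cbn; intros u.
  - destruct u. apply idm.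
  - exact (m u).
  - destruct u.
  - apply idm.
Defined.

Definition star_diagram : Functor Star C.
Proof.
  refine {| fob := star_ob; fmap := star_map |}.
  - now intros [s|].
  - intros [s|] [s'|] [s''|] g f; cbn in *;
      try destruct f; try destruct g; cbn; now rewrite ?comp_idl, ?comp_idr.
Defined.

(** The leg [q] to the centre is a separate datum, so that the notion matches limiting cones of
    [star_diagram] even when every [T s] is empty. *)
Definition IsStarLimit (v : C) (q : Hom v b) (p : forall s, Hom v (o s)) : Prop :=
  (forall s (t : T s), m t ∘ p s = q) /\
  forall (w : C) (q' : Hom w b) (p' : forall s, Hom w (o s)),
    (forall s (t : T s), m t ∘ p' s = q') ->
    exists! u : Hom w v, q ∘ u = q' /\ forall s, p s ∘ u = p' s.

Definition star_leg (v : C) (q : Hom v b) (p : forall s, Hom v (o s)) (i : Star) :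
  Hom v (star_diagram i) :=
  match i return Hom v (star_diagram i) with Some s => p s | None => q end.

Lemma star_leg_natural (v : C) (q : Hom v b) (p : forall s, Hom v (o s)) :
  (forall s (t : T s), m t ∘ p s = q) ->
  forall (i j : Star) (u : Hom i j),
    fmap star_diagram u ∘ star_leg q p i = star_leg q p j.
Proof.
  intros H [s|] [s'|] u; cbn in *; try destruct u; cbn; auto using comp_idl.
Qed.

Definition star_cone (v : C) (q : Hom v b) (p : forall s, Hom v (o s))
  (H : forall s (t : T s), m t ∘ p s = q) : Cone star_diagram :=
  {| vertex := v; leg := star_leg q p; leg_natural := star_leg_natural H |}.

Lemma star_cone_limit (v : C) (q : Hom v b) (p : forall s, Hom v (o s))
  (H : forall s (t : T s), m t ∘ p s = q) :
  IsStarLimit q p -> IsLimit (star_cone H).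
Proof.
  intros [_ Hu] d.
  destruct (Hu (vertex d) (leg d None) (fun s => leg d (Some s))) as [u [[Hq Hp] Huu]].
  - intros s t. exact (leg_natural d (i := Some s) (j := None) t).
  - exists u. split.
    + intros [s|]; cbn; auto.
    + intros u' Hu'. apply Huu. split; [exact (Hu' None)|].
      intros s. exact (Hu' (Some s)).
Qed.

Lemma limit_star (c : Cone star_diagram) :
  IsLimit c -> IsStarLimit (leg c None) (fun s => leg c (Some s)).
Proof.
  intros Hc. split.
  - intros s t. exact (leg_natural c (i := Some s) (j := None) t).
  - intros w q' p' H. destruct (Hc (star_cone H)) as [u [Hl Hu]].
    exists u. split.
    + split; [exact (Hl None)|]. intros s. exact (Hl (Some s)).
    + intros u' [Hq Hp]. apply Hu. intros [s|]; cbn; auto.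
Qed.

End Star.

Lemma star_limit_preserved (S : Type) (T : S -> Type) (C D : Category)
  (F : Functor C D) (o : S -> C) (b : C) (m : forall s, T s -> Hom (o s) b)
  (v : C) (q : Hom v b) (p : forall s, Hom v (o s)) :
  Finite S -> (forall s, Finite (T s)) -> PreservesFiniteLimits F ->
  IsStarLimit m q p ->
  IsStarLimit (fun s t => fmap F (m s t)) (fmap F q) (fun s => fmap F (p s)).
Proof.
  intros HS HT HF Hl. pose proof (proj1 Hl) as H.
  pose proof (HF _ (Star_finite HS HT) _ _ (star_cone_limit H Hl)) as HL.
  split.
  - intros s t. now rewrite <- fmap_comp, H.
  - intros w q' p' H'.
    (* The image cone lies over [functor_comp F (star_diagram m)], not over the star diagram of the
       images: identities become [fmap F (idm _)]. The competing cone is therefore built directly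
       over the composite. *)
    assert (N : forall (i j : Star T) (u : Hom i j),
      fmap (functor_comp F (star_diagram m)) u ∘
        (match i return Hom w (functor_comp F (star_diagram m) i) with
         | Some s => p' s | None => q' end)
      = match j return Hom w (functor_comp F (star_diagram m) j) with
         | Some s => p' s | None => q' end).
    { intros [s|] [s'|] u; cbn in *; try destruct u; cbn;
        rewrite ?fmap_id; auto using comp_idl. }
    destruct (HL {| vertex := w; leg_natural := N |}) as [u [Hu Huu]].
    exists u. split.
    + split; [exact (Hu None)|]. intros s. exact (Hu (Some s)).
    + intros u' [Hq Hp]. apply Huu. intros [s|]; cbn; auto.
Qed.

(** * Pullbacks, equalizers and their preservation *)

Lemma Finite_bool : Finite bool.
Proof. exists (true :: false :: nil). intros []; cbn; auto. Qed.

Lemma Finite_unit : Finite unit.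
Proof. exists (tt :: nil). intros []; cbn; auto. Qed.

Section PullbackStar.

Variables (C : Category) (x y z : C) (f : Hom x z) (g : Hom y z).

Definition cospan_ob (s : bool) : C := if s then x else y.

Definition cospan_map (s : bool) : unit -> Hom (cospan_ob s) z :=
  fun _ => match s return Hom (cospan_ob s) z with true => f | false => g end.

Definition span_leg (w : C) (a : Hom w x) (b : Hom w y) (s : bool) :
  Hom w (cospan_ob s) :=
  match s return Hom w (cospan_ob s) with true => a | false => b end.

Lemma star_pullback (p : C) (q : Hom p z) (l : forall s, Hom p (cospan_ob s)) :
  IsStarLimit cospan_map q l -> IsPullback f g (l true) (l false).
Proof.
  intros [H Hu]. split.
  - exact (eq_trans (H true tt) (eq_sym (H false tt))).
  - intros w a b E. destruct (Hu w (f ∘ a) (span_leg a b)) as [u [[Hq Hp] Huu]].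
    + intros [] t; cbn; auto.
    + exists u. split; [split; [exact (Hp true)|exact (Hp false)]|].
      intros u' [H1 H2]. apply Huu. split.
      * rewrite <- (H true tt). cbn. now rewrite <- comp_assoc, H1.
      * now intros [].
Qed.

Lemma pullback_star (p : C) (p1 : Hom p x) (p2 : Hom p y) :
  IsPullback f g p1 p2 -> IsStarLimit cospan_map (f ∘ p1) (span_leg p1 p2).
Proof.
  intros [E Hu]. split.
  - intros [] t; cbn; auto.
  - intros w q' p' H. destruct (Hu w (p' true) (p' false)) as [u [[H1 H2] Huu]].
    + exact (eq_trans (H true tt) (eq_sym (H false tt))).
    + exists u. split; [split|].
      * rewrite <- comp_assoc, H1. exact (H true tt).
      * now intros [].
      * intros u' [_ Hp]. apply Huu. split; [exact (Hp true)|exact (Hp false)].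
Qed.

End PullbackStar.

Lemma pullback_exists (C : Category) (HC : FinitelyComplete C) (x y z : C)
  (f : Hom x z) (g : Hom y z) : inhabited (Pullback f g).
Proof.
  destruct (HC _ (Star_finite Finite_bool (fun _ => Finite_unit))
              (star_diagram (cospan_map f g))) as [c Hc].
  constructor. exact {| pb_spec := star_pullback (limit_star Hc) |}.
Qed.

(** [Protomodular] speaks about a chosen family of pullbacks, while completeness only gives their
    existence; [epsilon] with a trivial predicate selects one for each cospan. *)
Definition pullback_choice (C : Category) (HC : FinitelyComplete C) :
  PullbackChoice C :=
  fun x y z f g => epsilon (pullback_exists HC f g) (fun _ => True).

Lemma preserves_pullback (C D : Category) (F : Functor C D) (x y z p : C)
  (f : Hom x z) (g : Hom y z) (p1 : Hom p x) (p2 : Hom p y) :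
  PreservesFiniteLimits F -> IsPullback f g p1 p2 ->
  IsPullback (fmap F f) (fmap F g) (fmap F p1) (fmap F p2).
Proof.
  intros HF Hp.
  pose proof (star_limit_preserved Finite_bool (fun _ => Finite_unit) HF
                (pullback_star Hp)) as [H Hu].
  split.
  - now rewrite <- !fmap_comp, (proj1 Hp).
  - intros w a b E.
    destruct (Hu w (fmap F f ∘ a)
      (fun s => match s return Hom w (F (cospan_ob x y s)) with
                | true => a | false => b end)) as [u [[Hq Hl] Huu]].
    + intros [] t; cbn; auto.
    + exists u. split; [split; [exact (Hl true)|exact (Hl false)]|].
      intros u' [H1 H2]. apply Huu. split.
      * now rewrite fmap_comp, <- comp_assoc, H1.
      * now intros [].
Qed.

Definition IsEqualizer (C : Category) (e x y : C) (f g : Hom x y) (i : Hom e x) :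
  Prop :=
  f ∘ i = g ∘ i /\
  forall (w : C) (a : Hom w x), f ∘ a = g ∘ a -> exists! u : Hom w e, i ∘ u = a.

Lemma equalizer_mono (C : Category) (e x y : C) (f g : Hom x y) (i : Hom e x) :
  IsEqualizer f g i -> IsMono i.
Proof.
  intros [E Hu] w a b H. destruct (Hu w (i ∘ b)) as [u [_ Huu]].
  - now rewrite !comp_assoc, E.
  - transitivity u; [symmetry|]; auto.
Qed.

Section EqualizerStar.

Variables (C : Category) (x y : C) (f g : Hom x y).

Definition parallel_map (s : unit) (t : bool) : Hom x y := if t then f else g.

Lemma star_equalizer (e : C) (q : Hom e y) (l : unit -> Hom e x) :
  IsStarLimit (o := fun _ => x) parallel_map q l -> IsEqualizer f g (l tt).
Proof.
  intros [H Hu]. split.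
  - exact (eq_trans (H tt true) (eq_sym (H tt false))).
  - intros w a E. destruct (Hu w (f ∘ a) (fun _ => a)) as [u [[Hq Hp] Huu]].
    + intros s []; cbn; auto.
    + exists u. split; [exact (Hp tt)|]. intros u' Hu'. apply Huu. split.
      * rewrite <- (H tt true). cbn. now rewrite <- comp_assoc, Hu'.
      * now intros [].
Qed.

Lemma equalizer_star (e : C) (i : Hom e x) :
  IsEqualizer f g i ->
  IsStarLimit (o := fun _ : unit => x) parallel_map (f ∘ i) (fun _ => i).
Proof.
  intros [E Hu]. split.
  - intros s []; cbn; auto.
  - intros w q' p' H. destruct (Hu w (p' tt)) as [u [Hi Huu]].
    + exact (eq_trans (H tt true) (eq_sym (H tt false))).
    + exists u. split; [split|].
      * rewrite <- comp_assoc, Hi. exact (H tt true).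
      * now intros [].
      * intros u' [_ Hp]. apply Huu. exact (Hp tt).
Qed.

End EqualizerStar.

Lemma equalizer_exists (C : Category) (HC : FinitelyComplete C) (x y : C)
  (f g : Hom x y) : exists (e : C) (i : Hom e x), IsEqualizer f g i.
Proof.
  destruct (HC _ (Star_finite Finite_unit (fun _ => Finite_bool))
              (star_diagram (o := fun _ => x) (parallel_map f g))) as [c Hc].
  eexists _, _. exact (star_equalizer (limit_star Hc)).
Qed.

Lemma preserves_equalizer (C D : Category) (F : Functor C D) (e x y : C)
  (f g : Hom x y) (i : Hom e x) :
  PreservesFiniteLimits F -> IsEqualizer f g i ->
  IsEqualizer (fmap F f) (fmap F g) (fmap F i).
Proof.
  intros HF He.
  pose proof (star_limit_preserved Finite_unit (fun _ => Finite_bool) HF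
                (equalizer_star He)) as H.
  apply (@star_equalizer _ _ _ (fmap F f) (fmap F g) _
           (fmap F (f ∘ i)) (fun _ => fmap F i)).
  replace (parallel_map (fmap F f) (fmap F g))
    with (fun s t => fmap F (parallel_map f g s t)); [exact H|].
  apply functional_extensionality; intros s.
  apply functional_extensionality; now intros [].
Qed.

(** The equalizer of [f] and [g] is sent to an equalizer of two equal arrows, which is invertible.
    By conservativity the equalizer itself is invertible, so [f = g]. *)
Lemma conservative_faithful (C D : Category) (F : Functor C D) :
  FinitelyComplete C -> PreservesFiniteLimits F -> Conservative F ->
  forall (x y : C) (f g : Hom x y), fmap F f = fmap F g -> f = g.
Proof.
  intros HC HF Hc x y f g E.
  destruct (equalizer_exists HC f g) as (e & i & Hi).
  pose proof (preserves_equalizer HF Hi) as HFi.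
  destruct (Hc _ _ i) as [j [_ Hj]].
  - destruct (proj2 HFi _ (idm (F x))) as [j [Hj _]].
    { now rewrite E. }
    exists j. split; [|exact Hj].
    apply (equalizer_mono HFi). now rewrite comp_assoc, Hj, comp_idl, comp_idr.
  - rewrite <- (comp_idr f), <- (comp_idr g), <- Hj, !comp_assoc.
    now rewrite (proj1 Hi).
Qed.

(** * Comparing kernel pairs with kernel spans *)

(* R[f] <= R[f'], on generalized elements. *)
Definition KernelPairLe (C : Category) (a b b' : C) (f : Hom a b) (f' : Hom a b') :
  Prop :=
  forall (w : C) (x y : Hom w a), f ∘ x = f ∘ y -> f' ∘ x = f' ∘ y.

(* Ker f <= Ker f', on generalized elements of the kernel spans. *)
Definition KernelSpanLe (C : Category) (z a b b' : C) (f : Hom a b)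
  (f' : Hom a b') : Prop :=
  forall (w : C) (h : Hom w a) (e : Hom w z) (u : Hom z b) (u' : Hom z b'),
    f ∘ h = u ∘ e -> f' ∘ h = u' ∘ e.
Arguments KernelSpanLe {C} z {a b b'} f f'.

Lemma initial_arrow (C : Category) (z x : C) :
  IsInitial z -> exists u : Hom z x, True.
Proof. intros H. destruct (H x) as [u _]. now exists u. Qed.

Lemma initial_unique (C : Category) (z x : C) (u v : Hom z x) :
  IsInitial z -> u = v.
Proof.
  intros H. destruct (H x) as [t [_ Ht]].
  transitivity t; [symmetry|]; auto.
Qed.

Lemma terminal_unique (C : Category) (t x : C) (u v : Hom x t) :
  IsTerminal t -> u = v.
Proof.
  intros H. destruct (H x) as [s [_ Hs]].
  transitivity s; [symmetry|]; auto.
Qed.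

(** With [v] the arrow from [z] to [a], initiality gives [u = f ∘ v], so an element [(h, e)] of the
    kernel span yields the element [(h, v ∘ e)] of R[f]. *)
Lemma kernel_pair_le_span_le (C : Category) (z a b b' : C) (f : Hom a b)
  (f' : Hom a b') :
  IsInitial z -> KernelPairLe f f' -> KernelSpanLe z f f'.
Proof.
  intros Hz H w h e u u' E. destruct (initial_arrow a Hz) as [v _].
  rewrite (initial_unique u (f ∘ v) Hz), <- comp_assoc in E.
  rewrite (initial_unique u' (f' ∘ v) Hz), <- comp_assoc. now apply H.
Qed.

Lemma kernel_span_le_pair_le (C : Category) (z a b b' : C) (f : Hom a b)
  (f' : Hom a b') :
  FinitelyComplete C -> Protomodular C -> IsInitial z ->
  KernelSpanLe z f f' -> KernelPairLe f f'.
Proof.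
  intros HC HP Hz HK.
  set (pb := pullback_choice HC).
  set (R := pb _ _ _ f f).
  set (p1 := pb_fst R). set (p2 := pb_snd R).
  assert (HR : f ∘ p1 = f ∘ p2) by apply (pb_spec R).
  enough (Hp : f' ∘ p1 = f' ∘ p2).
  { intros w x y E. destruct (proj2 (pb_spec R) w x y E) as [t [[Hx Hy] _]].
    rewrite <- Hx, <- Hy. fold p1 p2. now rewrite !comp_assoc, Hp. }
  (* [E] is the intersection of R[f] and R[f']; the goal follows once [i] has a section. *)
  destruct (equalizer_exists HC (f' ∘ p1) (f' ∘ p2)) as (E & i & Hi).
  pose proof (equalizer_mono Hi) as Hm.
  set (d := pb_lift R (eq_refl (f ∘ idm a))).
  assert (Hd1 : p1 ∘ d = idm a) by apply pb_lift_fst.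
  assert (Hd2 : p2 ∘ d = idm a) by apply pb_lift_snd.
  (* The diagonal factors through [E], which makes [i] a morphism of points over [a]. *)
  destruct (proj2 Hi _ d) as [d' [Hd' _]].
  { now rewrite <- !comp_assoc, Hd1, Hd2. }
  assert (Hs : (p1 ∘ i) ∘ d' = idm a) by now rewrite <- comp_assoc, Hd'.
  set (P := {| pt_split := Hd1 |} : Points a).
  set (P' := {| pt_split := Hs |} : Points a).
  set (phi := {| pth_mor := i : Hom (pt_ob P') (pt_ob P);
                 pth_epi := eq_refl; pth_sec := Hd' |} : Hom P' P).
  destruct (initial_arrow a Hz) as [v _].
  destruct (HP pb _ _ v P' P phi) as [g [_ Hg]].
  (* An element of [K] is a pair in R[f] with first component [v ∘ e]; its second component lies in
     the kernel span of [f]. By [HK] it also lies in that of [f'], so [pb_fst K] factors through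
     [E], and this gives an inverse [t] to the pulled-back inclusion. *)
  - set (K := pb _ _ _ p1 v). set (K' := pb _ _ _ (p1 ∘ i) v).
    assert (HKc : p1 ∘ pb_fst K = v ∘ pb_snd K) by apply (pb_spec K).
    destruct (proj2 Hi _ (pb_fst K)) as [s [Hsi _]].
    { rewrite <- !comp_assoc. symmetry.
      rewrite HKc, (comp_assoc f' v).
      apply (HK _ _ _ (f ∘ v)).
      now rewrite comp_assoc, <- HR, <- !comp_assoc, HKc. }
    assert (Hc : (p1 ∘ i) ∘ s = v ∘ pb_snd K)
      by now rewrite <- comp_assoc, Hsi.
    set (t := pb_lift K' Hc).
    pose (phi' := pth_mor (pull_hom pb v phi) : Hom (pb_ob K') (pb_ob K)).
    assert (Hphi1 : pb_fst K ∘ phi' = i ∘ pb_fst K') by apply pb_lift_fst.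
    assert (Hphi2 : pb_snd K ∘ phi' = pb_snd K') by apply pb_lift_snd.
    assert (Ht1 : pb_fst K' ∘ t = s) by apply pb_lift_fst.
    assert (Ht2 : pb_snd K' ∘ t = pb_snd K) by apply pb_lift_snd.
    assert (L : t ∘ phi' = idm _).
    { apply (pb_jointly_monic (P := K')).
      - apply Hm.
        now rewrite (comp_assoc (pb_fst K')), Ht1, comp_assoc, Hsi, Hphi1, comp_idr.
      - now rewrite comp_assoc, Ht2, Hphi2, comp_idr. }
    assert (Rt : phi' ∘ t = idm _).
    { apply (pb_jointly_monic (P := K)).
      - now rewrite comp_assoc, Hphi1, <- comp_assoc, Ht1, Hsi, comp_idr.
      - now rewrite comp_assoc, Hphi2, Ht2, comp_idr. }
    assert (Hsec : t ∘ pt_sec (pull_point pb v P) = pt_sec (pull_point pb v P')).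
    { rewrite <- (pth_sec (pull_hom pb v phi)), comp_assoc.
      exact (eq_trans (f_equal (fun k => k ∘ _) L) (comp_idl _)). }
    exists {| pth_mor := t : Hom (pt_ob (pull_point pb v P))
                               (pt_ob (pull_point pb v P'));
              pth_epi := Ht2; pth_sec := Hsec |}.
    split; apply PointHom_eq; [exact L|exact Rt].
  - assert (Hg' : i ∘ pth_mor g = idm (pb_ob R))
      by exact (f_equal (@pth_mor _ _ _ _) Hg).
    rewrite <- (comp_idr (f' ∘ p1)), <- (comp_idr (f' ∘ p2)).
    rewrite <- Hg', 2!(comp_assoc _ i). now rewrite (proj1 Hi).
Qed.

(** Preservation: the universal case is the pair of projections of R[f], whose image is the kernel
    pair of [fmap F f]. Reflection: apply the hypothesis to images of elements and use
    faithfulness. *)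
Lemma kernel_pair_le_fmap (C D : Category) (F : Functor C D)
  (HC : FinitelyComplete C) (HF : PreservesFiniteLimits F) (Hc : Conservative F)
  (a b b' : C) (f : Hom a b) (f' : Hom a b') :
  KernelPairLe f f' <-> KernelPairLe (fmap F f) (fmap F f').
Proof.
  set (R := pullback_choice HC f f).
  split; intros H.
  - intros w x y E.
    destruct (proj2 (preserves_pullback HF (pb_spec R)) w x y E)
      as [t [[Hx Hy] _]].
    rewrite <- Hx, <- Hy, !comp_assoc, <- !fmap_comp.
    rewrite (H _ (pb_fst R) (pb_snd R)); [reflexivity|].
    apply (pb_spec R).
  - intros w x y E. apply (conservative_faithful HC HF Hc).
    rewrite !fmap_comp. apply H. now rewrite <- !fmap_comp, E.
Qed.

(** * The orders on normal spans and U-ideals through kernels *)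

Lemma kernel_span_exists (C : Category) (z a b : C) (f : Hom a b) :
  FinitelyComplete C -> IsInitial z ->
  exists (k : C) (e : Hom k z) (h : Hom k a), IsKernelSpan f e h.
Proof.
  intros HC Hz. destruct (initial_arrow b Hz) as [u _].
  set (P := pullback_choice HC f u).
  exists (pb_ob P), (pb_snd P), (pb_fst P), u. apply pb_spec.
Qed.

(** A Yoneda argument: kernel spans represent the elements quantified over in [KernelSpanLe], and
    the comparison arrow comes from the universal element [(ns_h s, ns_e s)]. *)
Lemma NormalSpan_le_kernel (C : Category) (z a b b' : C) (s t : NormalSpan z a)
  (f : Hom a b) (f' : Hom a b') :
  IsInitial z -> IsKernelSpan f (ns_e s) (ns_h s) ->
  IsKernelSpan f' (ns_e t) (ns_h t) ->
  NormalSpan_le s t <-> KernelSpanLe z f f'.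
Proof.
  intros Hz [u0 [Hs Hsu]] [u0' [Ht Htu]]. split.
  - intros (eta & He & Hh) w h e u u' E.
    rewrite (initial_unique u u0 Hz) in E. rewrite (initial_unique u' u0' Hz).
    destruct (Hsu w h e E) as [k [[Hk1 Hk2] _]].
    rewrite <- Hk1, <- Hk2, <- Hh, <- He, !comp_assoc. now rewrite Ht.
  - intros H. destruct (Htu _ (ns_h s) (ns_e s)) as [eta [[H1 H2] _]].
    + exact (H _ _ _ u0 u0' Hs).
    + now exists eta.
Qed.

(** Each zero morphism may come with its own zero object; this moves all of them to one fixed
    [z]. *)
Lemma zero_morphism_through (C : Category) (z x y : C) (k : Hom x y) :
  IsZeroObject z ->
  IsZeroMorphism k <-> exists (u : Hom z y) (t : Hom x z), k = u ∘ t.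
Proof.
  intros Hz. split.
  - intros (z' & u' & t' & Hz' & E).
    destruct (initial_arrow z (proj1 Hz')) as [j _].
    destruct (initial_arrow y (proj1 Hz)) as [u _].
    exists u, (j ∘ t'). rewrite comp_assoc, E. f_equal.
    apply (initial_unique _ _ (proj1 Hz')).
  - intros (u & t & E). now exists z, u, t.
Qed.

(** When [z] is also terminal, the component into [z] carries no information, so the leg [i] of the
    kernel span is a kernel in the usual sense. *)
Lemma kernel_exists (C : Category) (z x y : C) (g : Hom x y) :
  FinitelyComplete C -> IsZeroObject z ->
  exists (k : C) (i : Hom k x), IsKernel g i.
Proof.
  intros HC Hz.
  destruct (kernel_span_exists g HC (proj1 Hz)) as (k & e & i & u & Hp & Hu).
  exists k, i. split.
  - apply (zero_morphism_through _ Hz). eauto.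
  - intros w h Hh. apply (zero_morphism_through _ Hz) in Hh.
    destruct Hh as (u' & t & E). rewrite (initial_unique u' u (proj1 Hz)) in E.
    destruct (Hu w h t E) as [l [[Hl1 _] Hl]].
    exists l. split; [exact Hl1|]. intros l' Hl'. apply Hl.
    split; [exact Hl'|]. apply (terminal_unique _ _ (proj2 Hz)).
Qed.

Lemma UIdeal_le_kernel (C D : Category) (U : Functor C D) (z : D) (a b b' : C)
  (s t : UIdeal U a) (f : Hom a b) (f' : Hom a b') :
  IsZeroObject z -> IsKernel (fmap U f) (ui_mor s) ->
  IsKernel (fmap U f') (ui_mor t) ->
  UIdeal_le s t <-> KernelSpanLe z (fmap U f) (fmap U f').
Proof.
  intros Hz [Hs Hsu] [Ht Htu]. split.
  - intros [j Hj] w h e u u' E.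
    destruct (Hsu w h) as [k [Hk _]].
    { apply (zero_morphism_through _ Hz). eauto. }
    apply (zero_morphism_through _ Hz) in Ht. destruct Ht as (v & r & Hv).
    rewrite <- Hk, <- Hj, !comp_assoc, Hv, <- !comp_assoc.
    rewrite (initial_unique v u' (proj1 Hz)). f_equal.
    apply (terminal_unique _ _ (proj2 Hz)).
  - intros H. destruct (Htu _ (ui_mor s)) as [j [Hj _]].
    + apply (zero_morphism_through _ Hz) in Hs. destruct Hs as (u & r & E).
      destruct (initial_arrow (U b') (proj1 Hz)) as [u' _].
      apply (zero_morphism_through _ Hz). exists u', r. exact (H _ _ _ u u' E).
    + now exists j.
Qed.

(** * Isomorphisms of poset reflections *)

Lemma functional_choice (A B : Type) (R : A -> B -> Prop) :
  (forall x, exists y, R x y) -> exists f : A -> B, forall x, R x (f x).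
Proof.
  intros H.
  exists (fun x => proj1_sig (constructive_indefinite_description _ (H x))).
  intros x. apply proj2_sig.
Qed.

Definition class_of (P : Preorder) (p : P) : EquivClass P :=
  exist _ (pre_equiv p) (ex_intro _ p eq_refl).

Lemma class_rep (P : Preorder) :
  exists r : EquivClass P -> P, forall S, proj1_sig S = pre_equiv (r S).
Proof.
  apply (functional_choice
           (R := fun (S : EquivClass P) (p : P) => proj1_sig S = pre_equiv p)).
  intros S. exact (proj2_sig S).
Qed.

(** Choice functions [phi] and [psi] for [Rel] are monotone, and mutually inverse up to equivalence,
    because [Rel] is compatible with the orders. The reflection turns equivalence into equality. *)
Lemma poset_reflection_iso (P Q : Preorder) (Rel : P -> Q -> Prop) :
  (forall p, exists q, Rel p q) -> (forall q, exists p, Rel p q) ->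
  (forall p p' q q', Rel p q -> Rel p' q' -> pre_le p p' <-> pre_le q q') ->
  PosetIso (poset_reflection P) (poset_reflection Q).
Proof.
  intros HP HQ HR.
  destruct (functional_choice HP) as [phi Hphi].
  destruct (functional_choice (R := fun q p => Rel p q) HQ) as [psi Hpsi].
  destruct (class_rep P) as [rP HrP], (class_rep Q) as [rQ HrQ].
  assert (HeP : forall p, pre_equiv (rP (class_of p)) p).
  { intros p. rewrite <- HrP. cbn. split; apply (pre_is_preorder P). }
  assert (HeQ : forall q, pre_equiv (rQ (class_of q)) q).
  { intros q. rewrite <- HrQ. cbn. split; apply (pre_is_preorder Q). }
  exists (fun S => class_of (phi (rP S))), (fun S => class_of (psi (rQ S))).
  split; [|split; [|split]].
  - intros S S' H. apply (class_le_rep (HrP S) (HrP S')) in H.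
    apply (@class_le_rep Q (class_of _) (class_of _) _ _ eq_refl eq_refl).
    exact (proj1 (HR _ _ _ _ (Hphi _) (Hphi _)) H).
  - intros S S' H. apply (class_le_rep (HrQ S) (HrQ S')) in H.
    apply (@class_le_rep P (class_of _) (class_of _) _ _ eq_refl eq_refl).
    exact (proj2 (HR _ _ _ _ (Hpsi _) (Hpsi _)) H).
  (* The representative of the class of [phi (rP S)] is only equivalent to it; [HR] carries both
     inequalities back to [P]. *)
  - intros S. destruct (HeQ (phi (rP S))) as [H1 H2].
    apply (@po_antisym (poset_reflection P)).
    + apply (@class_le_rep P (class_of _) S _ _ eq_refl (HrP S)).
      exact (proj2 (HR _ _ _ _ (Hpsi _) (Hphi _)) H1).
    + apply (@class_le_rep P S (class_of _) _ _ (HrP S) eq_refl).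
      exact (proj2 (HR _ _ _ _ (Hphi _) (Hpsi _)) H2).
  - intros S. destruct (HeP (psi (rQ S))) as [H1 H2].
    apply (@po_antisym (poset_reflection Q)).
    + apply (@class_le_rep Q (class_of _) S _ _ eq_refl (HrQ S)).
      exact (proj1 (HR _ _ _ _ (Hphi _) (Hpsi _)) H1).
    + apply (@class_le_rep Q S (class_of _) _ _ (HrQ S) eq_refl).
      exact (proj1 (HR _ _ _ _ (Hpsi _) (Hphi _)) H2).
Qed.

Theorem theorem5p12 (A X : Category) (zero : A) (U : Functor A X)
  (hA : Prohomological zero) (hX : Homological X)
  (hU : RegularFunctor U) (hUc : Conservative U) (a : A) :
  PosetIso (NormalSpanPoset zero a) (UIdealPoset U a).
Proof.
  destruct hA as ((HAc & Hzero & _) & _ & HAp).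
  destruct hX as ([z Hz] & (HXc & _) & HXp).
  destruct hU as [HU _].
  (* A span and an ideal correspond when a common [f] induces both. Independence of the choice of
     [f] is part of the order comparison in the last bullet. *)
  apply (poset_reflection_iso (P := NormalSpan_preorder zero a)
    (Q := UIdeal_preorder U a)
    (Rel := fun s t => exists (b : A) (f : Hom a b),
       IsKernelSpan f (ns_e s) (ns_h s) /\ IsKernel (fmap U f) (ui_mor t))).
  - intros [k e h (b & f & Hf)].
    destruct (kernel_exists (fmap U f) HXc Hz) as (i & m & Hm).
    exists {| ui_kernel := ex_intro _ b (ex_intro _ f Hm) |}.
    now exists b, f.
  - intros [i m (b & f & Hm)].
    destruct (kernel_span_exists f HAc Hzero) as (k & e & h & Hf).
    exists {| ns_normal := ex_intro _ b (ex_intro _ f Hf) |}.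
    now exists b, f.
  - intros s s' t t' (b & f & Hs & Ht) (b' & f' & Hs' & Ht'). cbn.
    rewrite (NormalSpan_le_kernel Hzero Hs Hs'), (UIdeal_le_kernel Hz Ht Ht').
    pose proof (kernel_pair_le_fmap HAc HU hUc f f') as HF.
    (* Both directions pass through kernel pairs: the first uses protomodularity of [A], the second
       that of [X]. *)
    split; intros H.
    + apply kernel_pair_le_span_le; [apply Hz|]. apply HF.
      exact (kernel_span_le_pair_le HAc HAp Hzero H).
    + apply kernel_pair_le_span_le; [exact Hzero|]. apply HF.
      exact (kernel_span_le_pair_le HXc HXp (proj1 Hz) H).
Qed.
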